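(* If the pseudo-marginal kernel $\tilde P$ has a nonzero spectral gap, that is $\operatorname{Gap}(\tilde P)>0$, then there exists a function $\bar w:\mathsf X\to[1,\infty)$ such that $Q_x([0,\bar w(x)])=1$ for $\pi$-almost every $x\in\mathsf X$.
   Context: Let $(\mathsf X,\mathcal B(\mathsf X))$ be a measurable space, $\pi$ a probability measure on it and $q(x,\mathrm dy)$ a Markov kernel on $\mathsf X$. The function $r(x,y)=\frac{\pi(\mathrm dy)q(y,\mathrm dx)}{\pi(\mathrm dx)q(x,\mathrm dy)}$ is the Radon--Nikodym derivative in the sense of Tierney: there is a symmetric measurable set $R\subset\mathsf X^2$ on which the measures $\pi(\mathrm dx)q(x,\mathrm dy)$ and $\pi(\mathrm dy)q(y,\mathrm dx)$ are mutually absolutely continuous, and on whose complement they are mutually singular; on $R$, $r$ is the density of the second with respect to the first, with values in $(0,\infty)$ and $r(x,y)r(y,x)=1$; off $R$, $r:=0$. Let $\mathsf W$ be a Borel subset of $\mathbb R_+=[0,\infty)$ and let $x\mapsto Q_x$ be a probability kernel from $\mathsf X$ to $\mathsf W$ with $\int w\,Q_x(\mathrm dw)=1$ for all $x$. Put $\pi_x(\mathrm dw)=w\,Q_x(\mathrm dw)$ and $\tilde\pi(\mathrm dx,\mathrm dw)=\pi(\mathrm dx)\pi_x(\mathrm dw)$. The pseudo-marginal kernel is $\tilde P(x,w;\mathrm dy,\mathrm du)=\min\{1,r(x,y)\frac uw\}q(x,\mathrm dy)Q_y(\mathrm du)+\delta_{x,w}(\mathrm dy,\mathrm du)\tilde\rho(x,w)$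 with $\tilde\rho(x,w)=1-\iint\min\{1,r(x,y)\frac uw\}q(x,\mathrm dy)Q_y(\mathrm du)$; it is reversible with respect to $\tilde\pi$. (If $0\in\mathsf W$, read $\min\{1,r(x,y)u/w\}$ as $1$ for $w=0$; the set $\{w=0\}$ is $\tilde\pi$-null.) For a Markov kernel $\Pi$ reversible with respect to a probability $\mu$, $\mathcal E_\Pi(g)=\langle g,(I-\Pi)g\rangle_\mu=\frac12\int\mu(\mathrm dx)\Pi(x,\mathrm dy)[g(x)-g(y)]^2$ and the (right) spectral gap is $\operatorname{Gap}(\Pi)=\inf\{\mathcal E_\Pi(g)/\operatorname{var}_\mu(g):\mu(g^2)<\infty,\operatorname{var}_\mu(g)>0\}$, with $\operatorname{var}_\mu(g)=\mu((g-\mu(g))^2)$. *)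

(* Defs.v *)
From HB Require Import structures.
From mathcomp Require Import all_boot all_order all_algebra.
From mathcomp Require Import all_classical all_reals all_analysis.
From mathcomp Require Import measurable_realfun.

Set Implicit Arguments.
Unset Strict Implicit.
Unset Printing Implicit Defensive.
Import Order.TTheory GRing.Theory Num.Theory.
Import numFieldNormedType.Exports.

Local Open Scope classical_set_scope.
Local Open Scope ring_scope.
Local Open Scope ereal_scope.

(* A subset W of R as a measurable space in its own right, with the trace of
   the Borel sigma-algebra.  MathComp-Analysis measurable types are pointed,
   hence the nonemptiness proof; this excludes nothing, since a space that
   carries a probability is nonempty. *)
Section weight_space.
Context (R : realType).

Definition weight_space (W : set R) (_ : W !=set0) : Type := W.

Variables (W : set R) (W_neq0 : W !=set0).
Local Notation WT := (weight_space W_neq0).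

HB.instance Definition _ := Choice.on WT.

Let W_point : WT :=
  exist _ (projT1 (cid W_neq0)) (mem_set (projT2 (cid W_neq0))).

HB.instance Definition _ := isPointed.Build WT W_point.

Definition wval (w : WT) : R := sval w.

HB.instance Definition _ := Measurable.copy WT
  (g_sigma_algebra_preimageType (wval : WT -> R)).

Lemma measurable_wval : measurable_fun [set: WT] wval.
Proof. by move=> _ B mB; exists B. Qed.

Lemma wval_ge0 (W_ge0 : W `<=` `[0%R, +oo[) (w : WT) :
  (0 <= wval w)%R.
Proof.
by have := W_ge0 _ (set_mem (svalP w)); rewrite /= in_itv /= andbT.
Qed.

End weight_space.

Section kernel_pull.
Context (d1 d2 d3 : measure_display) (Z : measurableType d1)
  (X : measurableType d2) (Y : measurableType d3) (R : realType).

Definition kernel_pull (k : R.-pker X ~> Y) (h : Z -> X)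
  (mh : measurable_fun [set: Z] h) : Z -> {measure set Y -> \bar R} :=
  fun z => k (h z).

Variables (k : R.-pker X ~> Y) (h : Z -> X) (mh : measurable_fun [set: Z] h).

Let measurable_kernel_pull U : measurable U ->
  measurable_fun [set: Z] (kernel_pull k mh ^~ U).
Proof. by move=> mU; apply: (measurableT_comp (measurable_kernel k U mU)). Qed.

HB.instance Definition _ := isKernel.Build _ _ _ _ _ (kernel_pull k mh)
  measurable_kernel_pull.

Let kernel_pull_prob z : kernel_pull k mh z [set: Y] = 1.
Proof. exact: prob_kernel. Qed.

HB.instance Definition _ := Kernel_isProbability.Build _ _ _ _ _
  (kernel_pull k mh) kernel_pull_prob.

End kernel_pull.

(* The measure mu(dx) k(x, dy) on X * Y. *)
Section joint.
Context (d1 d2 : measure_display) (X : measurableType d1)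
  (Y : measurableType d2) (R : realType).

Definition joint (mu : probability X R) (k : R.-pker X ~> Y) :
  set (X * Y) -> \bar R := fun A => \int[mu]_x k x (xsection A x).

Variables (mu : probability X R) (k : R.-pker X ~> Y).

Let joint0 : joint mu k set0 = 0.
Proof.
by rewrite /joint integral0_eq// => x _; rewrite xsection0 measure0.
Qed.

Let joint_ge0 A : 0 <= joint mu k A.
Proof. exact: integral_ge0. Qed.

Let joint_sigma_additive : semi_sigma_additive (joint mu k).
Proof.
move=> F mF tF mUF; rewrite [X in _ --> X](_ : _ =
  \int[mu]_x (\sum_(n <oo) k x (xsection (F n) x))); last first.
  apply: eq_integral => x _; rewrite xsection_bigcup.
  apply/esym/cvg_lim => //; apply: measure_semi_sigma_additive.
  - by move=> n; exact: measurable_xsection.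
  - exact: trivIset_xsection.
  - by apply: bigcup_measurable => n _; exact: measurable_xsection.
apply/cvg_closeP; split.
  by apply: is_cvg_nneseries => n _ _; exact: integral_ge0.
rewrite closeE// integral_nneseries// => n.
by apply: measurable_fun_xsection_finite_kernel; rewrite inE.
Qed.

HB.instance Definition _ := isMeasure.Build _ _ _
  (joint mu k) joint0 joint_ge0 joint_sigma_additive.

Let joint_setT : joint mu k setT = 1.
Proof.
rewrite /joint (eq_integral (cst 1)) => [|x _]; last first.
  rewrite (_ : xsection _ _ = setT) ?prob_kernel//.
  by apply/seteqP; split => // y _; rewrite /xsection /= inE.
by rewrite integral_cst// mul1e; exact: probability_setT.
Qed.

HB.instance Definition _ := Measure_isProbability.Build _ _ _
  (joint mu k) joint_setT.

End joint.

(* r is the Radon-Nikodym derivative pi(dy)q(y,dx) / (pi(dx)q(x,dy)) in the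
   sense of Tierney, with S the symmetric set on which the two measures are
   mutually absolutely continuous. *)
Section tierney.
Context (d : measure_display) (X : measurableType d) (R : realType).
Variables (pi : probability X R) (q : R.-pker X ~> X).

Local Notation mu := (joint pi q).
Local Notation nu := (pushforward (joint pi q) (@swap_pair X X)).

Record tierney_density (S : set (X * X)) (r : X * X -> R) : Prop := {
  tierney_measurable_set : measurable S ;
  tierney_sym : forall x y, S (x, y) -> S (y, x) ;
  tierney_ac_on : mrestr mu tierney_measurable_set
    `<< mrestr nu tierney_measurable_set ;
  tierney_ac_on_sym : mrestr nu tierney_measurable_set
    `<< mrestr mu tierney_measurable_set ;
  tierney_singular_off : exists B, [/\ measurable B, B `<=` ~` S,
    mu B = 0 & nu (~` S `\` B) = 0] ;
  tierney_measurable_fun : measurable_fun [set: X * X] r ;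
  tierney_derivative : forall A, measurable A -> A `<=` S ->
    nu A = \int[mu]_(z in A) (r z)%:E ;
  tierney_gt0 : forall x y, S (x, y) -> (0 < r (x, y))%R ;
  tierney_inv : forall x y, S (x, y) -> (r (x, y) * r (y, x) = 1)%R ;
  tierney_off : forall x y, ~ S (x, y) -> r (x, y) = 0%R }.

Lemma tierney_ge0 S r : tierney_density S r -> forall z, (0 <= r z)%R.
Proof.
move=> h [x y]; have [Sxy|/(tierney_off h) ->//] := pselect (S (x, y)).
exact/ltW/(tierney_gt0 h).
Qed.

End tierney.

(* The kernel pi_x(dw) = w Q_x(dw). *)
Section weighted_kernel.
Context (d : measure_display) (X : measurableType d) (R : realType).
Context (W : set R) (W_ge0 : W `<=` `[0%R, +oo[) (W_neq0 : W !=set0).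
Variable Q : R.-pker X ~> weight_space W_neq0.
Hypothesis Q_mean : forall x, \int[Q x]_w (wval w)%:E = 1.

Definition weighted_raw (x : X) (A : set (weight_space W_neq0)) : \bar R :=
  \int[Q x]_(w in A) (wval w)%:E.

Let mwval : measurable_fun [set: weight_space W_neq0]
  (fun w => (wval w)%:E : \bar R).
Proof. by apply/measurable_EFinP; exact: measurable_wval. Qed.

Let wval0 (w : weight_space W_neq0) : 0 <= (wval w)%:E.
Proof. by rewrite lee_fin; exact: wval_ge0. Qed.

Let weighted0 x : weighted_raw x set0 = 0.
Proof. exact: integral_set0. Qed.

Let weighted_raw_ge0 x A : 0 <= weighted_raw x A.
Proof. by apply: integral_ge0 => w _; exact: wval0. Qed.

Let weighted_sigma_additive x : semi_sigma_additive (weighted_raw x).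
Proof. exact: semi_sigma_additive_nng_induced. Qed.

Definition weighted_measure (x : X) : {measure set weight_space W_neq0 -> \bar R} :=
  HB.pack (weighted_raw x) (isMeasure.Build _ _ _ (weighted_raw x)
    (weighted0 x) (weighted_raw_ge0 x) (@weighted_sigma_additive x)).

Let measurable_weighted U : measurable U ->
  measurable_fun [set: X] (weighted_measure ^~ U).
Proof.
move=> mU; rewrite (_ : (fun x => _) = (fun x => \int[Q x]_w
    ((fun w => (wval w)%:E) \_ U) w)); last first.
  by apply/funext => x; rewrite /= /weighted_raw integral_mkcond.
apply: measurable_fun_integral_kernel.
- by move=> V mV; exact: measurable_kernel.
- by move=> w; apply: erestrict_ge0 => ? _; exact: wval0.
- by apply/(measurable_restrictT _ mU); exact: measurable_funTS.
Qed.

Let weighted_prob x : weighted_measure x setT = 1.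
Proof. exact: Q_mean. Qed.

Definition weighted_kernel : R.-pker X ~> weight_space W_neq0 :=
  let k := isKernel.Build _ _ _ _ _ weighted_measure measurable_weighted in
  let K : R.-ker X ~> _ := HB.pack weighted_measure k in
  HB.pack weighted_measure k
   (Kernel_isProbability.Build _ _ _ _ _ K weighted_prob).

End weighted_kernel.

Section pseudo_marginal.
Context (d : measure_display) (X : measurableType d) (R : realType).
Context (pi : probability X R) (q : R.-pker X ~> X).
Context (S : set (X * X)) (r : X * X -> R) (hr : tierney_density pi q S r).
Context (W : set R) (W_ge0 : W `<=` `[0%R, +oo[) (W_neq0 : W !=set0).
Variable Q : R.-pker X ~> weight_space W_neq0.

Local Notation WT := (weight_space W_neq0).

Definition pm_target (Q_mean : forall x, \int[Q x]_w (wval w)%:E = 1) :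
  probability (X * WT)%type R := joint pi (weighted_kernel W_ge0 Q_mean).

(* At w = 0 the rate min(1, r(x, y) u / w) is read as 1. *)
Definition pm_acc (xw yu : X * WT) : R :=
  if wval xw.2 == 0%R then 1%R
  else Num.min 1%R (r (xw.1, yu.1) * (wval yu.2 / wval xw.2))%R.

Definition pm_move (xw : X * WT) (A : set (X * WT)) : \bar R :=
  \int[q xw.1]_y \int[Q y]_u (pm_acc xw (y, u) * \1_A (y, u))%:E.

Definition pm_rho (xw : X * WT) : \bar R := 1 - pm_move xw setT.

Definition pm_kernel_raw (xw : X * WT) (A : set (X * WT)) : \bar R :=
  pm_move xw A + \d_xw A * pm_rho xw.

Lemma pm_acc_ge0 xw yu : (0 <= pm_acc xw yu)%R.
Proof.
rewrite /pm_acc; case: ifP => // _; rewrite le_min ler01 /=.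
apply: mulr_ge0; first exact: tierney_ge0 hr _.
by apply: divr_ge0; exact: wval_ge0.
Qed.

Lemma pm_acc_le1 xw yu : (pm_acc xw yu <= 1)%R.
Proof. by rewrite /pm_acc; case: ifP => // _; rewrite ge_min lexx. Qed.

Let measurable_inv : measurable_fun [set: R] (@GRing.inv R).
Proof.
rewrite (_ : @GRing.inv R = fun x => if x == 0%R then 0%R else x^-1)%R.
  apply: measurable_fun_if => //; first exact: measurable_fun_eqr.
  rewrite setTI (_ : _ @^-1` _ = [set x : R | x != 0%R]); last first.
    by apply/seteqP; split => x /=; case: eqP.
  apply: open_continuous_measurable_fun; last first.
    by move=> x; rewrite inE => /= x0; exact: inv_continuous.
  exact: open_neq.
by apply/funext => x; case: eqP => // ->; rewrite invr0.
Qed.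

Lemma measurable_pm_acc :
  measurable_fun [set: (X * WT) * (X * WT)] (fun z => pm_acc z.1 z.2).
Proof.
have m1 : measurable_fun [set: (X * WT) * (X * WT)] (fun z => wval z.1.2).
  apply: measurableT_comp; first exact: measurable_wval.
  by apply: (measurableT_comp measurable_snd); exact: measurable_fst.
have m2 : measurable_fun [set: (X * WT) * (X * WT)] (fun z => wval z.2.2).
  apply: measurableT_comp; first exact: measurable_wval.
  by apply: (measurableT_comp measurable_snd); exact: measurable_snd.
apply: measurable_fun_ifT => //=.
  by apply: measurable_fun_eqr.
apply: measurable_minr => //; apply: measurable_funM.
  apply: (measurableT_comp (tierney_measurable_fun hr)) => /=.
  apply: measurable_fun_pair => /=.
    by apply: (measurableT_comp measurable_fst); exact: measurable_fst.
  by apply: (measurableT_comp measurable_fst); exact: measurable_snd.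
by apply: measurable_funM => //; exact: (measurableT_comp measurable_inv).
Qed.

Let integrand (A : set (X * WT)) (z : ((X * WT) * X) * WT) : \bar R :=
  (pm_acc z.1.1 (z.1.2, z.2) * \1_A (z.1.2, z.2))%:E.

Let integrand_ge0 A z : 0 <= integrand A z.
Proof. by rewrite lee_fin mulr_ge0// pm_acc_ge0. Qed.

Let measurable_integrand A : measurable A ->
  measurable_fun [set: ((X * WT) * X) * WT] (integrand A).
Proof.
move=> mA; apply/measurable_EFinP.
have m2 : measurable_fun [set: ((X * WT) * X) * WT] (fun z => (z.1.2, z.2)).
  apply: measurable_fun_pair => //.
  by apply: (measurableT_comp measurable_snd); exact: measurable_fst.
apply: measurable_funM.
  apply: (measurableT_comp measurable_pm_acc
    (g := fun z : ((X * WT) * X) * WT => (z.1.1, (z.1.2, z.2)))).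
  apply: measurable_fun_pair => //.
  by apply: (measurableT_comp measurable_fst); exact: measurable_fst.
by apply: measurableT_comp => //; exact: measurable_indic.
Qed.

Let inner (A : set (X * WT)) (z : (X * WT) * X) : \bar R :=
  \int[Q z.2]_u integrand A (z, u).

Let inner_ge0 A z : 0 <= inner A z.
Proof. by apply: integral_ge0 => u _; exact: integrand_ge0. Qed.

Let measurable_inner A : measurable A ->
  measurable_fun [set: (X * WT) * X] (inner A).
Proof.
move=> mA.
exact: (measurable_fun_integral_finite_kernel (integrand A)
  (kernel_pull Q (@measurable_snd _ _ (X * WT)%type X))
  (integrand_ge0 A) (measurable_integrand mA)).
Qed.

Let pm_moveE xw A : pm_move xw A = \int[q xw.1]_y inner A (xw, y).
Proof. by []. Qed.

Let measurable_pm_move A : measurable A ->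
  measurable_fun [set: X * WT] (pm_move ^~ A).
Proof.
move=> mA.
exact: (measurable_fun_integral_finite_kernel (inner A)
  (kernel_pull q (@measurable_fst _ _ X WT))
  (inner_ge0 A) (measurable_inner mA)).
Qed.

Let pm_move_ge0 xw A : 0 <= pm_move xw A.
Proof. by rewrite pm_moveE; apply: integral_ge0 => y _; exact: inner_ge0. Qed.

Let pm_move0 xw : pm_move xw set0 = 0.
Proof.
rewrite /pm_move integral0_eq// => y _; rewrite integral0_eq// => u _.
by rewrite indic0 mulr0.
Qed.

Let inner_sigma z (F : (set (X * WT))^nat) : (forall n, measurable (F n)) ->
  trivIset setT F -> inner (\bigcup_n F n) z = \sum_(n <oo) inner (F n) z.
Proof.
move=> mF tF; rewrite /inner -integral_nneseries//; last first.
  move=> n; apply: (measurableT_comp (measurable_integrand (mF n))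
    (g := fun u => (z, u))).
  exact: measurable_pair1.
apply: eq_integral => u _; rewrite /integrand EFinM indic_bigcup//.
by rewrite -nneseriesZl.
Qed.

Let pm_move_sigma_additive xw : semi_sigma_additive (pm_move xw).
Proof.
move=> F mF tF mUF; rewrite [X in _ --> X](_ : _ =
    \sum_(n <oo) pm_move xw (F n)); last first.
  rewrite pm_moveE; under eq_integral do rewrite inner_sigma//.
  rewrite integral_nneseries// => n.
  apply: (measurableT_comp (measurable_inner (mF n)) (g := fun y => (xw, y))).
  exact: measurable_pair1.
by apply: is_cvg_nneseries => n _ _; exact: pm_move_ge0.
Qed.

Let pm_move_measure xw : {measure set (X * WT) -> \bar R} :=
  HB.pack (pm_move xw) (isMeasure.Build _ _ _ (pm_move xw)
    (pm_move0 xw) (pm_move_ge0 xw) (@pm_move_sigma_additive xw)).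

Lemma pm_move_le1 xw : pm_move xw setT <= 1.
Proof.
have le1 z : inner setT z <= 1.
  apply: (@le_trans _ _ (\int[Q z.2]_u 1)).
    apply: ge0_le_integral => //.
    - apply: (measurableT_comp (measurable_integrand measurableT)
        (g := fun u => (z, u))).
      exact: measurable_pair1.
    - by move=> u _; rewrite lee_fin indicT mulr1 pm_acc_le1.
  by rewrite integral_cst// mul1e prob_kernel.
rewrite pm_moveE; apply: (@le_trans _ _ (\int[q xw.1]_y 1)).
  apply: ge0_le_integral => //.
  apply: (measurableT_comp (measurable_inner measurableT)
    (g := fun y => (xw, y))).
  exact: measurable_pair1.
by rewrite integral_cst// mul1e prob_kernel.
Qed.

Lemma pm_rho_ge0 xw : 0 <= pm_rho xw.
Proof. by rewrite /pm_rho sube_ge0// ?pm_move_le1// orbT. Qed.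

Let pm_move_fin xw : pm_move xw setT \is a fin_num.
Proof.
by rewrite ge0_fin_numE// (le_lt_trans (pm_move_le1 xw))// ltry.
Qed.

Let rho_nng xw : {nonneg R} := NngNum (fine_ge0 (pm_rho_ge0 xw)).

Let pm_kernel_rawE xw A : pm_kernel_raw xw A =
  measure_add (pm_move_measure xw) (mscale (rho_nng xw) (dirac xw)) A.
Proof.
have rhoE : ((rho_nng xw)%:num)%:E = pm_rho xw.
  by apply: fineK; rewrite fin_numB pm_move_fin.
by rewrite /pm_kernel_raw muleC -rhoE measure_addE /mscale.
Qed.

Let pm_kernel0 xw : pm_kernel_raw xw set0 = 0.
Proof. by rewrite pm_kernel_rawE; exact: measure0. Qed.

Let pm_kernel_ge0 xw A : 0 <= pm_kernel_raw xw A.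
Proof. by rewrite pm_kernel_rawE; exact: measure_ge0. Qed.

Let pm_kernel_sigma_additive xw : semi_sigma_additive (pm_kernel_raw xw).
Proof.
rewrite (_ : pm_kernel_raw xw = measure_add (pm_move_measure xw)
  (mscale (rho_nng xw) (dirac xw))); last first.
  by apply/funext => A; exact: pm_kernel_rawE.
exact: measure_semi_sigma_additive.
Qed.

Definition pm_kernel_measure xw : {measure set (X * WT) -> \bar R} :=
  HB.pack (pm_kernel_raw xw) (isMeasure.Build _ _ _ (pm_kernel_raw xw)
    (pm_kernel0 xw) (pm_kernel_ge0 xw) (@pm_kernel_sigma_additive xw)).

Let measurable_pm_kernel A : measurable A ->
  measurable_fun [set: X * WT] (pm_kernel_measure ^~ A).
Proof.
move=> mA; rewrite /= /pm_kernel_raw; apply: emeasurable_funD.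
  exact: measurable_pm_move.
apply: emeasurable_funM.
  by apply/measurable_EFinP; exact: measurable_indic.
by apply: emeasurable_funB => //; exact: measurable_pm_move.
Qed.

Let pm_kernel_prob xw : pm_kernel_measure xw setT = 1.
Proof.
by rewrite /= /pm_kernel_raw diracT mul1e /pm_rho addeC subeK.
Qed.

(* hr and W_ge0 are used only for the measurability and sign of pm_acc. *)
Definition pm_kernel : R.-pker (X * WT) ~> (X * WT)%type :=
  let k := isKernel.Build _ _ _ _ _ pm_kernel_measure measurable_pm_kernel in
  let K : R.-ker (X * WT) ~> _ := HB.pack pm_kernel_measure k in
  HB.pack pm_kernel_measure k
    (Kernel_isProbability.Build _ _ _ _ _ K pm_kernel_prob).

Lemma pm_kernelE xw A : pm_kernel xw A =
  \int[q xw.1]_y \int[Q y]_u (pm_acc xw (y, u) * \1_A (y, u))%:E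
  + \d_xw A * pm_rho xw.
Proof. by []. Qed.

End pseudo_marginal.

Section spectral_gap.
Context (d : measure_display) (T : measurableType d) (R : realType).

(* This is <g, (I - P) g>_mu when P is reversible with respect to mu. *)
Definition dirichlet (mu : probability T R) (P : R.-pker T ~> T) (g : T -> R) :
  \bar R := 2^-1%:E * \int[mu]_x \int[P x]_y ((g x - g y) ^+ 2)%:E.

(* The infimum over the empty set is +oo. *)
Definition gap (mu : probability T R) (P : R.-pker T ~> T) : \bar R :=
  ereal_inf [set dirichlet mu P g / 'V_mu[g] | g in [set g : T -> R |
    [/\ measurable_fun [set: T] g, \int[mu]_x ((g x) ^+ 2)%:E < +oo
      & 0 < 'V_mu[g]]]].

End spectral_gap.

(* Main.v *)
Require Import Defs.
From HB Require Import structures.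
From mathcomp Require Import all_boot all_order all_algebra.
From mathcomp Require Import all_classical all_reals all_analysis.
From mathcomp Require Import measurable_realfun ring lra.

(** Why the theorem holds.  A state (x, w) whose weight w is large is sticky:
    the proposed weight u has mean one under Q_y, hence the probability that a
    proposal made at (x, w) is accepted is at most the integral of
    min(1, r(x, y) / w) against q(x, dy), which tends to 0 as w grows
    (pm_move_small).  A positive gap forbids sticky sets that are small but not
    null.  Given e with 2 e < Gap, let B be the set of the states (x, w) with
    w >= n whose acceptance probability is at most e, where n is so large that B
    has mass at most 1/2 (target_wval_ge_small).  The Dirichlet form of the
    indicator of B is at most e times the mass of B, and its variance is at least
    half the mass of B; therefore Gap <= 2 e unless B is null (pm_target_null).

    So B is null, and for almost every x its section at x is null for
    w Q_x(dw).  That section contains all weights beyond some level M(x), and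
    beyond level one the measure w Q_x(dw) dominates Q_x(dw); so
    max(1, n, M(x)) bounds Q_x-almost all weights.  The level M(x) is chosen for
    each x separately.

    The Dirichlet form counts the moves that enter B as well as those that leave
    it.  These have the same total mass by detailed balance
    (pm_detailed_balance).  The reason is that w times the acceptance rate is
    min(w, r(x, y) u), so that the flow from A to C has a density with respect to
    pi(dx) q(x, dy) Q_x(dw) Q_y(du); exchanging the two states turns this density
    into itself up to the factor r(x, y), which is exactly what the change of
    variables (x, y) -> (y, x) contributes. *)

Set Implicit Arguments.
Unset Strict Implicit.
Unset Printing Implicit Defensive.
Import Order.TTheory GRing.Theory Num.Theory.
Import numFieldNormedType.Exports.

Local Open Scope classical_set_scope.
Local Open Scope ring_scope.
Local Open Scope ereal_scope.

(** * Integration against mixtures and densities *)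

Section mixture.
Import HBNNSimple.

(** The common source of the integration formulas below: a measure with a
    density is a mixture of multiples of Dirac masses, and a joint law is a
    mixture of laws carried by the fibres. *)
Lemma ge0_integral_mixture d d' (X : measurableType d) (Y : measurableType d')
    (R : realType) (mu : {measure set X -> \bar R})
    (k : X -> {measure set Y -> \bar R}) (m : {measure set Y -> \bar R})
    (mk : forall A, measurable A -> measurable_fun [set: X] (k ^~ A))
    (mE : forall A, measurable A -> m A = \int[mu]_x k x A)
    (f : Y -> \bar R) (f0 : forall y, 0 <= f y)
    (mf : measurable_fun [set: Y] f) :
  \int[m]_y f y = \int[mu]_x \int[k x]_y f y.
Proof.
pose f_ := nnsfun_approx measurableT mf.
have mf_ n : measurable_fun [set: Y] (EFin \o f_ n) by exact/measurable_EFinP.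
have f_0 n y : 0 <= (f_ n y)%:E by rewrite lee_fin.
have f_nd y : {homo (fun n => (f_ n y)%:E) : a b / (a <= b)%N >-> a <= b}.
  by move=> a b ab; rewrite lee_fin; exact/lefP/nd_nnsfun_approx.
have f_lim (n : {measure set Y -> \bar R}) :
    \int[n]_y f y = limn (fun i => \int[n]_y (f_ i y)%:E).
  rewrite -monotone_convergence//; apply: eq_integral => y _.
  by apply/esym/cvg_lim => //; exact: cvg_nnsfun_approx.
have sintE (n : {measure set Y -> \bar R}) i : \int[n]_y (f_ i y)%:E =
    \sum_(c \in range (f_ i)) c%:E * n (f_ i @^-1` [set c]).
  by rewrite integralT_nnsfun sintegralE.
have mix i : \int[m]_y (f_ i y)%:E = \int[mu]_x \int[k x]_y (f_ i y)%:E.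
  rewrite sintE; under [RHS]eq_integral do rewrite sintE.
  rewrite ge0_integral_fsum//; last 2 first.
  - by move=> c; apply: measurable_funeM; exact: mk.
  - move=> c x _; apply: (mulemu_ge0 (fun c => f_ i @^-1` [set c])).
    exact: preimage_nnfun0.
  apply: eq_fsbigr => c; rewrite inE => -[y _ <-].
  by rewrite ge0_integralZl ?lee_fin// ?mE//; exact: mk.
rewrite f_lim; under [RHS]eq_integral do rewrite f_lim.
rewrite monotone_convergence//.
- by under eq_fun do rewrite mix.
- by move=> n; apply: measurable_fun_integral_kernel => //; exact: mf_.
- by move=> n x _; exact: integral_ge0.
- by move=> x _ a b ab; apply: ge0_le_integral => //; [exact: mf_|exact: mf_|
    by move=> y _; exact: f_nd].
Qed.

End mixture.

Lemma ge0_integral_density d (X : measurableType d) (R : realType)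
    (mu m : {measure set X -> \bar R}) (h : X -> R) (h0 : forall x, (0 <= h x)%R)
    (mh : measurable_fun [set: X] h)
    (mE : forall A, measurable A -> m A = \int[mu]_(x in A) (h x)%:E)
    (f : X -> \bar R) (f0 : forall x, 0 <= f x)
    (mf : measurable_fun [set: X] f) :
  \int[m]_x f x = \int[mu]_x ((h x)%:E * f x).
Proof.
pose k x : {measure set X -> \bar R} := mscale (NngNum (h0 x)) \d_x.
have kE x A : k x A = (h x)%:E * (\1_A x)%:E by [].
rewrite (@ge0_integral_mixture _ _ _ _ _ mu k m)//.
- apply: eq_integral => x _.
  by rewrite ge0_integral_mscale// integral_dirac// diracT mul1e.
- move=> A mA; under eq_fun do rewrite kE.
  by apply: emeasurable_funM; exact/measurable_EFinP.
- move=> A mA; rewrite mE// integral_mkcond; apply: eq_integral => x _.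
  by rewrite kE epatch_indic.
Qed.

Lemma ge0_integral_joint d d' (X : measurableType d) (Y : measurableType d')
    (R : realType) (mu : probability X R) (k : R.-pker X ~> Y)
    (f : X * Y -> \bar R) (f0 : forall z, 0 <= f z)
    (mf : measurable_fun [set: X * Y] f) :
  \int[joint mu k]_z f z = \int[mu]_x \int[k x]_y f (x, y).
Proof.
pose k' x : {measure set (X * Y) -> \bar R} := pushforward (k x) (pair x).
have mpair (x : X) : measurable_fun [set: Y] (pair x) by exact: pair1_measurable.
have kE x A : k' mpair x A = k x (xsection A x).
  by congr (k x _); apply/seteqP; split => y; rewrite /xsection /= inE.
rewrite (@ge0_integral_mixture _ _ _ _ _ mu (k' mpair))//.
- by apply: eq_integral => x _; rewrite ge0_integral_pushforward.
- move=> A mA; under eq_fun do rewrite kE.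
  by apply: measurable_fun_xsection_finite_kernel; rewrite inE.
- by move=> A mA; apply: eq_integral => x _; rewrite kE.
Qed.

Lemma ge0_integral_weighted d (X : measurableType d) (R : realType)
    (W : set R) (W_ge0 : W `<=` `[0%R, +oo[) (W_neq0 : W !=set0)
    (Q : R.-pker X ~> weight_space W_neq0)
    (Q_mean : forall x, \int[Q x]_w (wval w)%:E = 1) (x : X)
    (f : weight_space W_neq0 -> \bar R) (f0 : forall w, 0 <= f w)
    (mf : measurable_fun [set: weight_space W_neq0] f) :
  \int[weighted_kernel W_ge0 Q_mean x]_w f w = \int[Q x]_w ((wval w)%:E * f w).
Proof.
apply: ge0_integral_density => //; first exact: wval_ge0.
exact: measurable_wval.
Qed.

(** Exchanging the two coordinates costs the factor r.  It vanishes off S,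
    so the left-hand side lives on S, and S is symmetric: this is the origin of
    the indicator on the right-hand side. *)
Lemma tierney_change_of_variables d (X : measurableType d) (R : realType)
    (pi : probability X R) (q : R.-pker X ~> X) (S : set (X * X))
    (r : X * X -> R) (hr : tierney_density pi q S r)
    (G : X * X -> \bar R) (G0 : forall z, 0 <= G z)
    (mG : measurable_fun [set: X * X] G) :
  \int[joint pi q]_z ((r z)%:E * G (swap_pair z)) =
  \int[joint pi q]_z ((\1_S z)%:E * G z).
Proof.
have mS := tierney_measurable_set hr.
have mswap : measurable_fun [set: X * X] (@swap_pair X X).
  by apply: measurable_fun_pair; [exact: measurable_snd|exact: measurable_fst].
pose nu : {measure set (X * X) -> \bar R} :=
  pushforward (mrestr (joint pi q) mS) (@swap_pair X X).
have nuE A : measurable A -> nu mswap A = \int[joint pi q]_(z in A) (r z)%:E.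
  move=> mA; rewrite /nu /= /pushforward /mrestr.
  rewrite (_ : _ `&` S = (@swap_pair X X) @^-1` (A `&` S)); last first.
    apply/seteqP; split => -[x y] /= [Ayx Sxy]; split=> //;
      exact: (tierney_sym hr).
  (* Off S the density r is zero, so that A may replace A `&` S. *)
  have := @tierney_derivative _ _ _ _ _ _ _ hr (A `&` S).
  rewrite /pushforward => ->//; last exact: measurableI.
  rewrite integral_mkcondr; apply: eq_integral => -[x y] _.
  rewrite patchE; case: ifPn => //; rewrite notin_setE => nS.
  by rewrite (tierney_off hr nS).
have r0 := tierney_ge0 hr; have mr := tierney_measurable_fun hr.
have mGswap : measurable_fun [set: X * X] (G \o @swap_pair X X).
  exact: measurableT_comp.
transitivity (\int[nu mswap]_z G (swap_pair z)).
  by apply/esym/ge0_integral_density => // z; exact: G0.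
transitivity (\int[mrestr (joint pi q) mS]_z G z).
  have -> : \int[nu mswap]_z G (swap_pair z) =
      \int[mrestr (joint pi q) mS]_z G (swap_pair (swap_pair z)).
    apply: (ge0_integral_pushforward mswap _ measurableT mGswap) => z _.
    exact: G0.
  by apply: eq_integral => -[].
apply: (ge0_integral_density (h := \1_S)) => // A mA.
by rewrite integral_indic// setIC.
Qed.

(** * Probability kernels *)

Lemma measurable_integral_integral d d' d'' (T : measurableType d)
    (Y : measurableType d') (Z : measurableType d'') (R : realType)
    (k : R.-pker T ~> Y) (l : R.-pker (T * Y) ~> Z) (f : (T * Y) * Z -> \bar R)
    (f0 : forall z, 0 <= f z) (mf : measurable_fun [set: (T * Y) * Z] f) :
  measurable_fun [set: T] (fun t => \int[k t]_y \int[l (t, y)]_z f (t, y, z)).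
Proof.
apply: (measurable_fun_integral_finite_kernel
  (fun ty => \int[l ty]_z f (ty, z)) k).
  by move=> ty; exact: integral_ge0.
exact: (measurable_fun_integral_finite_kernel f l).
Qed.

(** Each value of a probability kernel, as an object that carries the structure
    of a probability: Tonelli's theorem and the rule for complements can be
    applied to it. *)
Section pker_at.
Context d d' (X : measurableType d) (Y : measurableType d') (R : realType)
  (k : R.-pker X ~> Y) (x : X).

Definition pker_at : set Y -> \bar R := k x.

HB.instance Definition _ := isMeasure.Build _ _ _ pker_at
  (measure0 (k x)) (measure_ge0 (k x)) (@measure_semi_sigma_additive _ _ _ (k x)).

HB.instance Definition _ := Measure_isProbability.Build _ _ _ pker_at
  (@prob_kernel _ _ _ _ _ k x).

End pker_at.

Lemma pker_fubini_tonelli dX dY dX' dY' (X : measurableType dX)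
    (Y : measurableType dY) (X' : measurableType dX') (Y' : measurableType dY')
    (R : realType) (k : R.-pker X ~> Y) (l : R.-pker X' ~> Y') (x : X) (x' : X')
    (f : Y * Y' -> \bar R) (f0 : forall z, 0 <= f z)
    (mf : measurable_fun [set: Y * Y'] f) :
  \int[k x]_y \int[l x']_z f (y, z) = \int[l x']_z \int[k x]_y f (y, z).
Proof.
exact: (@fubini_tonelli _ _ _ _ _ (pker_at k x)
  (pker_at l x') f mf f0).
Qed.

Lemma measurable_pker_integral dY dX' dY' (Y : measurableType dY)
    (X' : measurableType dX') (Y' : measurableType dY')
    (R : realType) (l : R.-pker X' ~> Y') (x' : X')
    (f : Y * Y' -> \bar R) (f0 : forall z, 0 <= f z)
    (mf : measurable_fun [set: Y * Y'] f) :
  measurable_fun [set: Y] (fun y => \int[l x']_z f (y, z)).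
Proof.
exact: (@measurable_fun_fubini_tonelli_F _ _ _ _ _ (pker_at l x') f mf).
Qed.

(** * Acceptance probabilities and detailed balance *)

Section reversibility.
Context (R : realType) (d : measure_display) (X : measurableType d)
  (pi : probability X R) (q : R.-pker X ~> X)
  (S : set (X * X)) (r : X * X -> R) (hr : tierney_density pi q S r)
  (W : set R) (W_ge0 : W `<=` `[0%R, +oo[) (W_neq0 : W !=set0)
  (Q : R.-pker X ~> weight_space W_neq0)
  (Q_mean : forall x, \int[Q x]_w (wval w)%:E = 1).

Local Notation WT := (weight_space W_neq0).
Local Notation target := (pm_target pi W_ge0 Q_mean).
Local Notation move := (pm_move q r Q).

(** The integrand of [pm_move], as a function of the current state, the proposed
    point and the proposed weight, nested as the kernels are. *)
Let move_integrand C (z : ((X * WT) * X) * WT) : \bar R :=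
  (pm_acc r z.1.1 (z.1.2, z.2) * \1_C (z.1.2, z.2))%:E.

Let move_integrand_ge0 C z : 0 <= move_integrand C z.
Proof. by rewrite lee_fin mulr_ge0// (pm_acc_ge0 hr W_ge0). Qed.

Let measurable_move_integrand C : measurable C ->
  measurable_fun [set: ((X * WT) * X) * WT] (move_integrand C).
Proof.
move=> mC; apply/measurable_EFinP.
have m2 : measurable_fun [set: ((X * WT) * X) * WT] (fun z => (z.1.2, z.2)).
  apply: measurable_fun_pair => //.
  by apply: (measurableT_comp measurable_snd); exact: measurable_fst.
apply: measurable_funM.
  apply: (measurableT_comp (measurable_pm_acc hr (W_neq0 := W_neq0))
    (g := fun z : ((X * WT) * X) * WT => (z.1.1, (z.1.2, z.2)))).
  apply: measurable_fun_pair => //.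
  by apply: (measurableT_comp measurable_fst); exact: measurable_fst.
by apply: measurableT_comp => //; exact: measurable_indic.
Qed.

Let measurable_inner C x w : measurable C ->
  measurable_fun [set: X] (fun y => \int[Q y]_u move_integrand C (x, w, y, u)).
Proof.
move=> mC.
exact: (measurable_fun_pair2 (x, w) (measurable_fun_integral_finite_kernel
  (move_integrand C) (kernel_pull Q (@measurable_snd _ _ (X * WT)%type X))
  (move_integrand_ge0 C) (measurable_move_integrand mC))).
Qed.

Lemma measurable_pm_move C : measurable C ->
  measurable_fun [set: X * WT] (move ^~ C).
Proof.
move=> mC; exact: (measurable_integral_integral
  (kernel_pull q (@measurable_fst _ _ X WT))
  (kernel_pull Q (@measurable_snd _ _ (X * WT)%type X))
  (move_integrand_ge0 C) (measurable_move_integrand mC)).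
Qed.

Lemma pm_move_ge0 z C : 0 <= move z C.
Proof.
by apply: integral_ge0 => y _; apply: integral_ge0 => u _;
  rewrite lee_fin mulr_ge0// (pm_acc_ge0 hr W_ge0).
Qed.

Lemma pm_move_le_setT z C : measurable C -> move z C <= move z setT.
Proof.
move=> mC; case: z => x w.
have inner0 A y : 0 <= \int[Q y]_u move_integrand A (x, w, y, u).
  by apply: integral_ge0 => u _; exact: move_integrand_ge0.
have integrand_le y u :
    move_integrand C (x, w, y, u) <= move_integrand setT (x, w, y, u).
  by rewrite lee_fin indicT mulr1 ler_piMr ?(pm_acc_ge0 hr W_ge0)// indicE lern1 leq_b1.
rewrite /pm_move; apply: ge0_le_integral => [//||||].
- by move=> y _; exact: inner0.
- exact: measurable_inner.
- exact: measurable_inner.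
move=> y _; apply: ge0_le_integral => [//||||].
- by move=> u _; exact: (move_integrand_ge0 C (x, w, y, u)).
- exact: (measurable_fun_pair2 (x, w, y) (measurable_move_integrand mC)).
- exact: (measurable_fun_pair2 (x, w, y) (measurable_move_integrand measurableT)).
- by move=> u _; exact: integrand_le.
Qed.

(** The acceptance rate is at most 1 and at most r(x, y) u / w, and the
    proposed weight u has mean one. *)
Lemma pm_move_setT_le x (w : WT) : (0 < wval w)%R ->
  move (x, w) setT <= \int[q x]_y (Num.min 1 (r (x, y) / wval w))%:E.
Proof.
move=> w0; have r0 := tierney_ge0 hr; rewrite /pm_move.
have mr : measurable_fun [set: X] (fun y => r (x, y)).
  exact: (measurable_fun_pair2 x (tierney_measurable_fun hr)).
apply: ge0_le_integral => //.
- by move=> y _; apply: integral_ge0 => u _;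
    exact: (move_integrand_ge0 setT (x, w, y, u)).
- exact: measurable_inner.
- apply/measurable_EFinP; apply: measurable_minr => //.
  by apply: measurable_funM.
move=> y _; rewrite EFin_min le_min; apply/andP; split.
- rewrite -(@prob_kernel _ _ _ _ _ Q y) -[leRHS]mul1e -integral_cst//.
  apply: ge0_le_integral => //.
  + by move=> u _; exact: (move_integrand_ge0 setT (x, w, y, u)).
  + exact: (measurable_fun_pair2 (x, w, y) (measurable_move_integrand measurableT)).
  + by move=> u _; rewrite lee_fin indicT mulr1 pm_acc_le1.
- rewrite -[leRHS]mule1 -(Q_mean y) -ge0_integralZl//; last 3 first.
  + by apply/measurable_EFinP; exact: measurable_wval.
  + by move=> u _; rewrite lee_fin wval_ge0.
  + by rewrite lee_fin divr_ge0// ltW.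
  apply: ge0_le_integral => //.
  + by move=> u _; exact: (move_integrand_ge0 setT (x, w, y, u)).
  + exact: (measurable_fun_pair2 (x, w, y) (measurable_move_integrand measurableT)).
  + apply/measurable_EFinP; apply: measurable_funM => //.
    exact: measurable_wval.
  move=> u _; rewrite -EFinM lee_fin indicT mulr1 /pm_acc /= gt_eqF//.
  by rewrite ge_min mulrA mulrAC lexx orbT.
Qed.

(** Dominated convergence, along the integer weights: the bound of
    [pm_move_setT_le] decreases in the weight. *)
Lemma pm_move_small x (e : R) : (0 < e)%R ->
  exists M : R, forall w : WT, (M <= wval w)%R -> move (x, w) setT <= e%:E.
Proof.
move=> e0.
pose f n y := (Num.min 1 (r (x, y) / n.+1%:R))%R.
have r0 := tierney_ge0 hr.
have f0 n y : (0 <= f n y)%R by rewrite le_min ler01 divr_ge0.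
have mr : measurable_fun [set: X] (fun y => r (x, y)).
  exact: (measurable_fun_pair2 x (tierney_measurable_fun hr)).
have mf n : measurable_fun [set: X] (f n).
  by apply: measurable_minr => //; exact: measurable_funM.
have : \int[q x]_y (f n y)%:E @[n --> \oo] --> \int[q x]_y 0.
  apply: (@dominated_cvg _ _ _ _ _ _ _ _ (cst 1)) => //.
  - by move=> n; exact/measurable_EFinP.
  - move=> y _; apply: cvg_EFin; first exact: nearW.
    change (f ^~ y @ \oo --> 0%R).
    have h0 : (r (x, y) * harmonic n)%R @[n --> \oo] --> 0%R.
      rewrite -(mulr0 (r (x, y))).
      by apply: cvgM; [exact: cvg_cst|exact: cvg_harmonic].
    apply: squeeze_cvgr (cvg_cst 0%R) h0.
    by apply: nearW => n; rewrite f0 ge_min lexx orbT.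
  - apply/integrableP; split => //.
    under eq_integral do rewrite /= normr1.
    by rewrite integral_cst// prob_kernel mule1 ltry.
  - move=> n y _; rewrite gee0_abs lee_fin//.
    by rewrite ge_min lexx.
rewrite integral0 => cvg0.
have [n _ small] : \forall n \near \oo, \int[q x]_y (f n y)%:E < e%:E.
  apply: (cvg0 [set z | z < e%:E]).
  by apply: (@nbhs_open_ereal_lt _ _ (cst e)).
exists n.+1%:R => w nw.
have w0 : (0 < wval w)%R by apply: lt_le_trans nw.
apply: (le_trans (pm_move_setT_le x w0)).
apply: le_trans (ltW (small n (leqnn n))).
apply: ge0_le_integral => //.
- by move=> y _; rewrite lee_fin le_min ler01 divr_ge0// ltW.
- by apply/measurable_EFinP; apply: measurable_minr => //; exact: measurable_funM.
- exact/measurable_EFinP.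
- move=> y _; rewrite lee_fin; apply: le_min2 => //.
  by rewrite ler_wpM2l// lef_pV2 ?posrE.
Qed.

(** The density of the flow from A to C with respect to the law
    pi(dx) q(x, dy) Q_x(dw) Q_y(du), see [wval_pm_acc]. *)
Definition pm_flux (A C : set (X * WT)) (xy : X * X) (wu : WT * WT) : R :=
  (Num.min (wval wu.1) (r xy * wval wu.2) *
   (\1_A (xy.1, wu.1) * \1_C (xy.2, wu.2)))%R.

Lemma pm_flux_ge0 A C xy wu : (0 <= pm_flux A C xy wu)%R.
Proof.
rewrite mulr_ge0// ?mulr_ge0// le_min wval_ge0//=.
by rewrite mulr_ge0 ?(tierney_ge0 hr)// wval_ge0.
Qed.

Lemma measurable_pm_flux A C : measurable A -> measurable C ->
  measurable_fun [set: (X * X) * (WT * WT)] (fun z => pm_flux A C z.1 z.2).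
Proof.
move=> mA mC.
have mfst1 : measurable_fun [set: (X * X) * (WT * WT)] (fun z => z.1.1).
  by apply: (measurableT_comp measurable_fst); exact: measurable_fst.
have mfst2 : measurable_fun [set: (X * X) * (WT * WT)] (fun z => z.1.2).
  by apply: (measurableT_comp measurable_snd); exact: measurable_fst.
have msnd1 : measurable_fun [set: (X * X) * (WT * WT)] (fun z => z.2.1).
  by apply: (measurableT_comp measurable_fst); exact: measurable_snd.
have msnd2 : measurable_fun [set: (X * X) * (WT * WT)] (fun z => z.2.2).
  by apply: (measurableT_comp measurable_snd); exact: measurable_snd.
have mw := @measurable_wval R W W_neq0.
apply: measurable_funM; last apply: measurable_funM.
- apply: measurable_minr; first exact: (measurableT_comp mw).
  apply: measurable_funM; last exact: (measurableT_comp mw).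
  exact: (measurableT_comp (tierney_measurable_fun hr) measurable_fst).
- apply: (measurableT_comp (measurable_indic mA)
    (g := fun z : (X * X) * (WT * WT) => (z.1.1, z.2.1))).
  exact: measurable_fun_pair.
- apply: (measurableT_comp (measurable_indic mC)
    (g := fun z : (X * X) * (WT * WT) => (z.1.2, z.2.2))).
  exact: measurable_fun_pair.
Qed.

(** On S this is min(w, r(x, y) u) = r(x, y) min(u, r(y, x) w); off S both sides
    vanish because weights are nonnegative. *)
Lemma pm_flux_swap A C xy w u :
  pm_flux A C xy (w, u) = (r xy * pm_flux C A (swap_pair xy) (u, w))%R.
Proof.
case: xy => x y; rewrite /pm_flux /= [RHS]mulrA (mulrC (\1_C _)%R).
congr (_ * _)%R.
have r0 := tierney_ge0 hr (x, y).
have [Sxy|nS] := pselect (S (x, y)).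
  by rewrite minr_pMr// mulrA (tierney_inv hr Sxy) mul1r minC.
by rewrite (tierney_off hr nS) !mul0r min_r// wval_ge0.
Qed.

Lemma pm_flux_indic A C xy wu :
  pm_flux A C xy wu = (\1_S xy * pm_flux A C xy wu)%R.
Proof.
rewrite indicE; case: (boolP (xy \in S)) => [|/negP nS]; first by rewrite mul1r.
rewrite mul0r /pm_flux; case: xy nS => x y nS.
rewrite (tierney_off hr (y := y)) ?mul0r ?min_r ?wval_ge0 ?mul0r//.
by move=> Sxy; apply: nS; rewrite inE.
Qed.

Definition pm_flow A C xy := \int[Q xy.1]_w \int[Q xy.2]_u (pm_flux A C xy (w, u))%:E.

Lemma pm_flow_ge0 A C xy : 0 <= pm_flow A C xy.
Proof.
by apply: integral_ge0 => w _; apply: integral_ge0 => u _; rewrite lee_fin pm_flux_ge0.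
Qed.

Lemma measurable_pm_flow A C : measurable A -> measurable C ->
  measurable_fun [set: X * X] (pm_flow A C).
Proof.
move=> mA mC.
pose k := kernel_pull Q (@measurable_fst _ _ X X).
pose l := kernel_pull (kernel_pull Q (@measurable_snd _ _ X X))
  (@measurable_fst _ _ (X * X)%type WT).
apply: (measurable_integral_integral k l
  (f := fun z => (pm_flux A C z.1.1 (z.1.2, z.2))%:E)).
  by move=> z; rewrite lee_fin pm_flux_ge0.
apply/measurable_EFinP.
apply: (measurableT_comp (measurable_pm_flux mA mC)
  (g := fun z : ((X * X) * WT) * WT => (z.1.1, (z.1.2, z.2)))).
apply: measurable_fun_pair => //.
  by apply: (measurableT_comp measurable_fst); exact: measurable_fst.
apply: measurable_fun_pair => //.
by apply: (measurableT_comp measurable_snd); exact: measurable_fst.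
Qed.

Lemma pm_flow_swap A C xy : measurable A -> measurable C ->
  pm_flow A C xy = (r xy)%:E * pm_flow C A (swap_pair xy).
Proof.
move=> mA mC.
have mflux (A' C' : set (X * WT)) z : measurable A' -> measurable C' ->
    measurable_fun [set: WT * WT] (fun wu => (pm_flux A' C' z wu)%:E).
  move=> mA' mC'; apply/measurable_EFinP.
  exact: (measurable_fun_pair2 _ (measurable_pm_flux mA' mC')).
have mswap : measurable_fun [set: WT * WT]
    (fun wu => (pm_flux C A (swap_pair xy) (wu.2, wu.1))%:E).
  apply: (measurableT_comp (mflux C A (swap_pair xy) mC mA)
    (g := fun wu : WT * WT => (wu.2, wu.1))).
  by apply: measurable_fun_pair; [exact: measurable_snd|exact: measurable_fst].
have pos w u : 0 <= (pm_flux C A (swap_pair xy) (u, w))%:E.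
  by rewrite lee_fin pm_flux_ge0.
have -> : pm_flow C A (swap_pair xy) =
    \int[Q xy.1]_w \int[Q xy.2]_u (pm_flux C A (swap_pair xy) (u, w))%:E.
  apply/esym/(pker_fubini_tonelli _ _ _ _ _ mswap) => z.
  exact: pos.
rewrite /pm_flow -ge0_integralZl ?lee_fin ?(tierney_ge0 hr)//; last 2 first.
- by apply: (measurable_pker_integral Q xy.2 _ mswap) => z; exact: pos.
- by move=> w _; apply: integral_ge0 => u _; exact: pos.
apply: eq_integral => w _.
rewrite -ge0_integralZl ?lee_fin ?(tierney_ge0 hr)//; last first.
  exact: (measurable_fun_pair2 w mswap).
by apply: eq_integral => u _; rewrite pm_flux_swap EFinM.
Qed.

Lemma pm_flow_indic A C xy : pm_flow A C xy = (\1_S xy)%:E * pm_flow A C xy.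
Proof.
rewrite indicE; case: (boolP (xy \in S)) => [|/negP nS]; first by rewrite mul1e.
rewrite mul0e; apply: integral0_eq => w _; apply: integral0_eq => u _.
by rewrite pm_flux_indic indicE (negbTE (introN idP nS)) mul0r.
Qed.

(** At weight zero every move is accepted, by convention; the factor w makes both
    sides vanish there. *)
Lemma wval_pm_acc x (w : WT) y (u : WT) :
  (wval w * pm_acc r (x, w) (y, u) = Num.min (wval w) (r (x, y) * wval u))%R.
Proof.
have w0 : (0 <= wval w)%R by exact: wval_ge0.
rewrite /pm_acc /=; case: eqP => [->|/eqP wn0].
  rewrite mul0r min_l// mulr_ge0 ?(tierney_ge0 hr)//; exact: wval_ge0.
by rewrite minr_pMr// mulr1 mulrCA (mulrC (wval w)) divfK.
Qed.

(** The weight that the target carries turns the acceptance rate into the flux,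
    and Tonelli lets q(x, dy) be integrated before Q_x(dw). *)
Lemma pm_target_flow A C : measurable A -> measurable C ->
  \int[target]_z ((\1_A z)%:E * move z C) = \int[joint pi q]_xy pm_flow A C xy.
Proof.
move=> mA mC.
have mmove := measurable_pm_move mC; have move0 := pm_move_ge0 ^~ C.
have mAmove : measurable_fun [set: X * WT] (fun z => (\1_A z)%:E * move z C).
  by apply: emeasurable_funM => //; exact/measurable_EFinP/measurable_indic.
rewrite [LHS]ge0_integral_joint; [|by move=> z; rewrite mule_ge0 ?lee_fin|by []].
rewrite ge0_integral_joint; [|exact: pm_flow_ge0|exact: measurable_pm_flow].
apply: eq_integral => x _.
rewrite ge0_integral_weighted; last 2 first.
- by move=> w; rewrite mule_ge0 ?lee_fin.
- exact: (measurable_fun_pair2 x mAmove).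
transitivity (\int[Q x]_w \int[q x]_y \int[Q y]_u (pm_flux A C (x, y) (w, u))%:E).
  apply: eq_integral => w _.
  have ww0 : (0 <= wval w * \1_A (x, w))%R by rewrite mulr_ge0// wval_ge0.
  rewrite muleA -EFinM /pm_move -ge0_integralZl ?lee_fin//; last 2 first.
  - exact: measurable_inner.
  - by move=> y _; apply: integral_ge0 => u _;
      exact: (move_integrand_ge0 C (x, w, y, u)).
  apply: eq_integral => y _; rewrite -ge0_integralZl ?lee_fin//; last 2 first.
  - exact: (measurable_fun_pair2 (x, w, y) (measurable_move_integrand mC)).
  - by move=> u _; exact: (move_integrand_ge0 C (x, w, y, u)).
  apply: eq_integral => u _; rewrite -EFinM /pm_flux /= -wval_pm_acc.
  by congr (_%:E); rewrite mulrACA.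
have mflux : measurable_fun [set: (WT * X) * WT]
    (fun z => (pm_flux A C (x, z.1.2) (z.1.1, z.2))%:E).
  apply/measurable_EFinP; apply: (measurableT_comp (measurable_pm_flux mA mC)
    (g := fun z : (WT * X) * WT => ((x, z.1.2), (z.1.1, z.2)))).
  apply: measurable_fun_pair; apply: measurable_fun_pair => //.
    exact: (measurableT_comp measurable_snd measurable_fst).
  exact: (measurableT_comp measurable_fst measurable_fst).
apply: (pker_fubini_tonelli Q q x x
  (f := fun wy => \int[Q wy.2]_u (pm_flux A C (x, wy.2) (wy.1, u))%:E)).
  by move=> wy; apply: integral_ge0 => u _; rewrite lee_fin pm_flux_ge0.
apply: (measurable_fun_integral_finite_kernel
  (fun z => (pm_flux A C (x, z.1.2) (z.1.1, z.2))%:E)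
  (kernel_pull Q (@measurable_snd _ _ WT X)) _ mflux) => z.
by rewrite lee_fin pm_flux_ge0.
Qed.

(** The flow from A to C equals the integral of r times the reversed flow from C
    to A at the exchanged point, and the change of variables absorbs r. *)
Lemma pm_detailed_balance A C : measurable A -> measurable C ->
  \int[target]_z ((\1_A z)%:E * move z C) =
  \int[target]_z ((\1_C z)%:E * move z A).
Proof.
move=> mA mC; apply: etrans (pm_target_flow mA mC) _.
apply: etrans _ (esym (pm_target_flow mC mA)).
under [LHS]eq_integral => z _ do rewrite (pm_flow_swap z mA mC).
rewrite (tierney_change_of_variables hr); last 2 first.
- exact: pm_flow_ge0.
- exact: measurable_pm_flow.
by apply: eq_integral => z _; rewrite -pm_flow_indic.
Qed.

End reversibility.

(** * Test functions that are indicators *)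

Lemma measurable_wval_ge (R : realType) d (X : measurableType d)
    (W : set R) (W_neq0 : W !=set0) (a : R) :
  measurable [set z : X * weight_space W_neq0 | (a <= wval z.2)%R].
Proof.
have mf : measurable_fun [set: X * weight_space W_neq0]
    (fun z => (wval z.2)%:E : \bar R).
  apply/measurable_EFinP.
  apply: (measurableT_comp _ measurable_snd); exact: measurable_wval.
by have := emeasurable_fun_c_infty measurableT mf a%:E; rewrite setTI.
Qed.

Section gap_indic.
Context d (T : measurableType d) (R : realType).

Lemma variance_indic (mu : probability T R) (B : set T) : measurable B ->
  'V_mu[\1_B] = mu B * (1 - mu B).
Proof.
move=> mB.
have mind : measurable_fun [set: T] (\1_B : T -> R) by exact: measurable_indic.
rewrite varianceE; last first.
  rewrite inE/=; apply/andP; split; rewrite inE//=.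
  rewrite /finite_norm unlock poweR_lty//.
  apply: (@le_lt_trans _ _ (\int[mu]_x 1)); last first.
    by rewrite integral_cst// mul1e -ge0_fin_numE// fin_num_measure.
  apply: ge0_le_integral => [//||||].
  - by move=> x _; rewrite lee_fin powR_ge0.
  - apply/measurable_EFinP/(measurableT_comp (measurable_powR _)).
    exact: measurableT_comp.
  - exact: measurable_cst.
  - by move=> x _; rewrite lee_fin powR_mulrn// indicE; case: (_ \in _);
      rewrite ?normr0 ?normr1 ?expr0n ?expr1n.
rewrite (_ : (\1_B ^+ 2)%R = \1_B :> (T -> R)) ?expectation_indic//; last first.
  apply/funext => x; rewrite expr2.
  change (\1_B x * \1_B x = \1_B x :> R)%R; rewrite indicE.
  by case: (_ \in _); rewrite ?mulr1 ?mulr0.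
by rewrite muleBr ?mule1 ?fin_num_measure// fin_num_adde_defr.
Qed.

Lemma dirichlet_indic (mu : probability T R) (P : R.-pker T ~> T) (B : set T) :
  measurable B ->
  dirichlet mu P \1_B = 2^-1%:E * (\int[mu]_x ((\1_B x)%:E * P x (~` B)) +
    \int[mu]_x ((\1_(~` B) x)%:E * P x B)).
Proof.
move=> mB; have mBC := measurableC mB; congr (_ * _).
have mind C D : measurable C -> measurable D ->
    measurable_fun [set: T] (fun x => (\1_C x)%:E * P x D).
  move=> mC mD; apply: emeasurable_funM; last exact: measurable_kernel.
  exact/measurable_EFinP.
have ind0 C D x : 0 <= (\1_C x)%:E * P x D by rewrite mule_ge0 ?lee_fin.
rewrite -ge0_integralD//; last 2 first.
- exact: mind.
- exact: mind.
apply: eq_integral => x _; rewrite !indicE in_setC.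
have [xB|xB] := boolP (x \in B); rewrite /= ?mul0e ?mul1e ?add0e ?adde0.
  rewrite -[X in _ = P x X]setIT -integral_indic//; apply: eq_integral => y _.
  by rewrite !indicE in_setC; case: (y \in B); rewrite /= ?subrr ?subr0 ?expr0n ?expr1n.
rewrite -[X in _ = P x X]setIT -integral_indic//; apply: eq_integral => y _.
by rewrite !indicE; case: (y \in B); rewrite /= ?subrr ?sub0r ?sqrrN ?expr0n ?expr1n.
Qed.

(** Under detailed balance between B and its complement, the mass that enters B
    equals the mass that leaves it, so a bound on the exit probability over B
    controls both halves of the Dirichlet form. *)
Lemma dirichlet_indic_le (mu : probability T R) (P : R.-pker T ~> T)
    (B : set T) (e : R) : measurable B -> (0 <= e)%R ->
  \int[mu]_x ((\1_B x)%:E * P x (~` B)) =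
    \int[mu]_x ((\1_(~` B) x)%:E * P x B) ->
  (forall x, B x -> P x (~` B) <= e%:E) ->
  dirichlet mu P \1_B <= e%:E * mu B.
Proof.
move=> mB e0 bal Be; rewrite dirichlet_indic// -bal.
have mBC := measurableC mB.
have out_le : \int[mu]_x ((\1_B x)%:E * P x (~` B)) <= e%:E * mu B.
  rewrite -[X in _ * mu X]setIT -integral_indic// -ge0_integralZl//; last first.
    exact/measurable_EFinP/measurable_indic.
  apply: ge0_le_integral => [//||||].
  - by move=> x _; rewrite mule_ge0 ?lee_fin.
  - apply: emeasurable_funM; first exact/measurable_EFinP/measurable_indic.
    exact: measurable_kernel.
  - by apply: measurable_funeM; exact/measurable_EFinP/measurable_indic.
  move=> x _; rewrite indicE.
  have [xB|_] := boolP (x \in B); last by rewrite mul0e mule0.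
  by rewrite mul1e mule1; exact: Be (set_mem xB).
apply: (@le_trans _ _ (2^-1%:E * (e%:E * mu B + e%:E * mu B))).
  by rewrite lee_wpmul2l// leeD.
have : mu B \is a fin_num by rewrite fin_num_measure.
by case: (mu B) => // p _; rewrite -!EFinM lee_fin; lra.
Qed.

(** A set of mass p <= 1/2 has variance p (1 - p) >= p / 2, which is where the
    factor 2 comes from. *)
Lemma gap_le_dirichlet_indic (mu : probability T R) (P : R.-pker T ~> T)
    (B : set T) (e : R) : measurable B -> (0 <= e)%R ->
  0 < mu B -> mu B <= (2^-1)%:E ->
  dirichlet mu P \1_B <= e%:E * mu B -> gap mu P <= (2 * e)%:E.
Proof.
move=> mB e0.
have := @variance_indic mu _ mB.
have : mu B \is a fin_num by rewrite fin_num_measure.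
case: (mu B) => // p _ VB; rewrite lte_fin lee_fin => p0 p2 dB.
have V0 : (0 < p * (1 - p))%R by rewrite mulr_gt0//; lra.
apply: ge_ereal_inf; exists (dirichlet mu P \1_B / 'V_mu[\1_B]).
  exists (\1_B : T -> R) => //; split.
  - exact: measurable_indic.
  - apply: (@le_lt_trans _ _ (\int[mu]_x 1)); last first.
      by rewrite integral_cst// mul1e -ge0_fin_numE// fin_num_measure.
    apply: ge0_le_integral => [//||||].
    + by move=> x _; rewrite lee_fin sqr_ge0.
    + by apply/measurable_EFinP/measurable_funX.
    + exact: measurable_cst.
    + by move=> x _; rewrite lee_fin indicE; case: (_ \in _);
        rewrite ?expr0n ?expr1n.
  - by rewrite VB -EFinB -EFinM lte_fin.
rewrite VB -EFinB -EFinM inver gt_eqF// lee_pdivrMr//.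
apply: le_trans dB _; rewrite -!EFinM lee_fin.
have -> : (2 * e * (p * (1 - p)) = e * p * (2 * (1 - p)))%R by ring.
by apply: ler_peMr; [rewrite mulr_ge0// ltW|lra].
Qed.

End gap_indic.

Section pseudo_marginal_gap.
Context (R : realType) (d : measure_display) (X : measurableType d)
  (pi : probability X R) (q : R.-pker X ~> X)
  (S : set (X * X)) (r : X * X -> R) (hr : tierney_density pi q S r)
  (W : set R) (W_ge0 : W `<=` `[0%R, +oo[) (W_neq0 : W !=set0)
  (Q : R.-pker X ~> weight_space W_neq0)
  (Q_mean : forall x, \int[Q x]_w (wval w)%:E = 1).

Local Notation WT := (weight_space W_neq0).
Local Notation target := (pm_target pi W_ge0 Q_mean).
Local Notation move := (pm_move q r Q).
Local Notation kernel := (pm_kernel hr W_ge0 Q).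

Lemma pm_dirichlet_indic_le (B : set (X * WT)) (e : R) : measurable B ->
  (0 <= e)%R -> (forall z, B z -> move z setT <= e%:E) ->
  dirichlet target kernel \1_B <= e%:E * target B.
Proof.
move=> mB e0 Be; have mBC := measurableC mB.
(* Away from the current state only the accepted moves contribute. *)
have offdiag (C D : set (X * WT)) z : C `&` D = set0 ->
    (\1_C z)%:E * kernel z D = (\1_C z)%:E * move z D.
  move=> CD0; rewrite indicE.
  have [zC|] := boolP (z \in C); rewrite ?mul0e// !mul1e pm_kernelE diracE.
  have /negbTE -> : z \notin D.
    apply/negP => zD; rewrite -[False]/(set0 z) -CD0.
    by split; exact: set_mem.
  by rewrite mul0e adde0.
apply: (dirichlet_indic_le mB e0).
  transitivity (\int[target]_z ((\1_B z)%:E * move z (~` B))).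
    by apply: eq_integral => z _; apply: offdiag; exact: setICr.
  apply: (etrans (pm_detailed_balance hr W_ge0 Q_mean mB mBC)).
  by apply/esym/eq_integral => z _; apply: offdiag; exact: setICl.
move=> z Bz; apply: le_trans (Be z Bz); rewrite pm_kernelE diracE in_setC.
rewrite mem_set//= mul0e adde0; exact: (pm_move_le_setT hr W_ge0).
Qed.

Lemma pm_target_null (B : set (X * WT)) (e : R) : measurable B ->
  (0 <= e)%R -> (forall z, B z -> move z setT <= e%:E) ->
  target B <= (2^-1)%:E -> (2 * e)%:E < gap target kernel -> target B = 0.
Proof.
move=> mB e0 Be B2 egap; apply/eqP; rewrite eq_le measure_ge0 andbT leNgt.
apply/negP => B0; move: egap; rewrite ltNge => /negP; apply.
by apply: (gap_le_dirichlet_indic mB) => //; exact: pm_dirichlet_indic_le.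
Qed.

Lemma target_wval_ge_small : exists n,
  target [set z : X * WT | (n%:R <= wval z.2)%R] <= (2^-1)%:E.
Proof.
pose F n := [set z : X * WT | (n%:R <= wval z.2)%R].
have mF n : measurable (F n) by exact: measurable_wval_ge.
have F0 : \bigcap_n F n = set0.
  apply/seteqP; split => // -[x w] Fxw.
  have := Fxw (Num.bound (wval w)) I; rewrite /F /= leNgt => /negP; apply.
  by rewrite archi_boundP// wval_ge0.
have : target \o F @ \oo --> target (\bigcap_n F n).
  apply: nonincreasing_cvg_mu => //.
  - by rewrite -ge0_fin_numE// fin_num_measure.
  - by rewrite F0.
  - move=> m n mn; rewrite subsetEset => z /=; apply: le_trans.
    by rewrite ler_nat.
rewrite F0 measure0 => cvg0.
have [n _ small] : \forall n \near \oo, target (F n) < (2^-1)%:E.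
  apply: (cvg0 [set t | t < (2^-1)%:E]).
  by apply: (@nbhs_open_ereal_lt _ _ (cst 2^-1%R)); rewrite /= invr_gt0.
by exists n; exact/ltW/small/leqnn.
Qed.

Lemma target_null_section (B : set (X * WT)) : measurable B -> target B = 0 ->
  {ae pi, forall x, weighted_kernel W_ge0 Q_mean x (xsection B x) = 0}.
Proof.
move=> mB B0.
have mk : measurable_fun [set: X]
    (fun x => weighted_kernel W_ge0 Q_mean x (xsection B x)).
  by apply: measurable_fun_xsection_finite_kernel; rewrite inE.
have : \int[pi]_x `|weighted_kernel W_ge0 Q_mean x (xsection B x)| = 0.
  by under eq_integral do rewrite gee0_abs//.
move/(ae_eq_integral_abs pi measurableT mk); apply: filterS => x /=; exact.
Qed.

(** Where the weight is at least one, w Q_x(dw) dominates Q_x(dw). *)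
Lemma weight_ge1_null (x : X) (D : set WT) : measurable D ->
  (forall w, D w -> (1 <= wval w)%R) ->
  weighted_kernel W_ge0 Q_mean x D = 0 -> Q x D = 0.
Proof.
move=> mD D1 D0; apply/eqP; rewrite eq_le measure_ge0 andbT -D0.
rewrite -[Q x D]mul1e -integral_cst//.
apply: ge0_le_integral => [//||||].
- by move=> w _; rewrite lee_fin.
- exact: measurable_cst.
- apply/measurable_EFinP/measurable_funTS; exact: measurable_wval.
- by move=> w Dw; rewrite lee_fin D1.
Qed.

End pseudo_marginal_gap.

(** * The essential bound on the weights *)

Theorem proposition13 (R : realType) (d : measure_display)
    (X : measurableType d) (pi : probability X R) (q : R.-pker X ~> X)
    (S : set (X * X)) (r : X * X -> R) (hr : tierney_density pi q S r)
    (W : set R) (mW : measurable W) (W_ge0 : W `<=` `[0%R, +oo[)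
    (W_neq0 : W !=set0) (Q : R.-pker X ~> weight_space W_neq0)
    (Q_mean : forall x, \int[Q x]_w (wval w)%:E = 1) :
  0 < gap (pm_target pi W_ge0 Q_mean) (pm_kernel hr W_ge0 Q) ->
  exists wbar : X -> R, (forall x, (1 <= wbar x)%R) /\
    {ae pi, forall x, Q x [set u | (0 <= wval u <= wbar x)%R] = 1}.
Proof.
move=> gap_gt0.
have [e e0 egap] : exists2 e : R, (0 < e)%R &
    (2 * e)%:E < gap (pm_target pi W_ge0 Q_mean) (pm_kernel hr W_ge0 Q).
  case: (gap _ _) gap_gt0 => [g| |//] g0; last first.
    by exists 1%R => //; exact: ltry.
  by exists (g / 4)%R; move: g0; rewrite !lte_fin => g0; lra.
have [n small_n] := target_wval_ge_small pi W_ge0 Q_mean.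
pose B := [set z : X * weight_space W_neq0 | (n%:R <= wval z.2)%R] `&`
  [set z | pm_move q r Q z setT <= e%:E].
have mB : measurable B.
  apply: measurableI; first exact: measurable_wval_ge.
  have := emeasurable_fun_infty_c measurableT
    (measurable_pm_move hr W_ge0 Q measurableT) e%:E.
  by rewrite setTI.
have B0 : pm_target pi W_ge0 Q_mean B = 0.
  apply: (pm_target_null mB (ltW e0) _ _ egap); first by move=> z [].
  apply: le_trans small_n; apply: le_measure; rewrite ?inE//.
    exact: measurable_wval_ge.
  by move=> z [].
have /choice[M smallM] : forall x, exists M : R,
    forall w : weight_space W_neq0, (M <= wval w)%R ->
    pm_move q r Q (x, w) setT <= e%:E.
  by move=> x; exact: (pm_move_small hr W_ge0 Q_mean).
pose wbar x : R := Num.max 1%R (Num.max n%:R (M x)).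
exists wbar; split.
  by move=> x; rewrite le_max lexx.
move: (target_null_section mB B0); apply: filterS => x Bx0.
pose c := wbar x.
pose D : set (weight_space W_neq0) := [set u | (c < wval u)%R].
have mD : measurable D.
  have -> : D = setT `&` @wval R W W_neq0 @^-1` `]c, +oo[.
    by rewrite setTI; apply/seteqP; split => u; rewrite /D /= in_itv /= andbT.
  apply: measurable_wval => //; exact: measurable_itv.
have D_ge1 w : D w -> (1 <= wval w)%R.
  by move=> /ltW; apply: le_trans; rewrite le_max lexx.
have QD0 : Q x D = 0.
  apply: (weight_ge1_null mD D_ge1); apply/eqP.
  rewrite eq_le measure_ge0 andbT -Bx0; apply: le_measure; rewrite ?inE//.
    exact: measurable_xsection.
  move=> w; rewrite /xsection /D /= gt_max => /andP[_].
  rewrite gt_max => /andP[nw Mw]; rewrite inE; split => /=; first exact: ltW.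
  exact/smallM/ltW.
have -> : [set u : weight_space W_neq0 | (0 <= wval u <= c)%R] = ~` D.
  by apply/seteqP; split => u /=; rewrite wval_ge0//= leNgt => /negP.
by have := probability_setC (pker_at Q x) mD; rewrite /pker_at QD0 sube0.
Qed.
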